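(* Let $m\in\mathbb{N}$ and let $A_1,\dots,A_m\subseteq\mathbb{N}$ with $\mathbb{N}=\bigcup_{i=1}^m A_i$. Then for all $n\in\mathbb{N}$ there exist $c_0,\dots,c_n\in[m]$ and an additive IP sequence $\langle x_\alpha\rangle_{\alpha\in\mathcal{P}_f(\mathbb{N})}$ such that for all $b\in[n]$ we have $$\{x_\alpha:\ \alpha\in\mathcal{P}_f(\mathbb{N})\}\subseteq A_{c_0}$$ and $$\Big\{\prod_{s=1}^{b+1}x_{\alpha_s}:\ \alpha_1,\dots,\alpha_{b+1}\in\mathcal{P}_f(\mathbb{N});\ s<t\Rightarrow \alpha_s<\alpha_t\Big\}\subseteq A_{c_b}.$$
   Context: $\mathbb{N}$ is the set of positive integers and $[m]=\{1,\dots,m\}$. For a nonempty set $S$, $\mathcal{P}_f(S)$ is the set of nonempty finite subsets of $S$. For $\alpha,\beta\in\mathcal{P}_f(\mathbb{N})$, $\alpha<\beta$ means $\max\alpha<\min\beta$. An additive IP sequence is a family $\langle x_\alpha\rangle_{\alpha\in\mathcal{P}_f(\mathbb{N})}$ of elements of $\mathbb{N}$ such that $x_{\alpha\cup\beta}=x_\alpha+x_\beta$ for all $\alpha,\beta\in\mathcal{P}_f(\mathbb{N})$ with $\alpha\cap\beta=\emptyset$. *)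

(* Defs.v *)
From mathcomp Require Import all_boot finmap classical_sets.
Set Implicit Arguments.
Unset Strict Implicit.
Unset Printing Implicit Defensive.

Local Open Scope classical_set_scope.

(* The positive integers, inside nat. *)
Definition posint : set nat := [set k | 0 < k].

Definition Pf (T : choiceType) (S : set T) : set {fset T} :=
  [set a | a != fset0 /\ [set k | k \in a] `<=` S].

Definition fset_max (a : {fset nat}) : nat := \max_(k <- a) k.

(* The neutral element fset_max a is harmless: for a nonempty a it is an
   element of a, so that this is the least element of a. *)
Definition fset_min (a : {fset nat}) : nat := \big[minn/fset_max a]_(k <- a) k.

Definition fset_lt (a b : {fset nat}) : Prop := fset_max a < fset_min b.

(* Only the values of x on Pf posint are meaningful. *)
Definition additive_IP (x : {fset nat} -> nat) : Prop :=
  (forall a, Pf posint a -> posint (x a)) /\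
  (forall a b, Pf posint a -> Pf posint b ->
     (a `&` b)%fset = fset0 -> x (a `|` b)%fset = x a + x b).

Definition IP_values (x : {fset nat} -> nat) : set nat := x @` Pf posint.

Definition IP_products (x : {fset nat} -> nat) (k : nat) : set nat :=
  [set \prod_(s < k) x (a s) | a in
    [set a : 'I_k -> {fset nat} |
      (forall s, Pf posint (a s)) /\
      (forall s t : 'I_k, s < t -> fset_lt (a s) (a t))]].

(* Main.v *)
Require Import Defs.
From mathcomp Require Import all_boot finmap boolp classical_sets filter.

Local Open Scope classical_set_scope.

(** Fix an ultrafilter V on the positive integers that is idempotent for the
convolution extending addition, that is: A is in V iff, for V-almost all x, for
V-almost all y, x + y lies in A.  Since V is an ultrafilter, for each b there
is one class A_(c_b) such that, for V-almost all x_1, for V-almost all x_2, ...,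
for V-almost all x_(b+1), the product x_1 ... x_(b+1) lies in A_(c_b)
([tensor_cover]).  This settles the colours; what remains is to choose y_0,
y_1, ... such that finite sums over successive blocks behave like these
V-generic numbers.

For this, idempotence gives a greedy construction ([filter_finite_sums]): given
requirements D(y_0, ..., y_(M-1)) in V, each allowed to depend on the earlier
choices, one can choose y so that every finite sum with least index M lies in
D(y_0, ..., y_(M-1)).  Take x_a to be the sum of the y_k over k in a.  A product
w of values x_a over blocks below M is bounded in terms of y_0, ..., y_(M-1), so
only finitely many w may precede a block with least index M, and one requirement
in V can ask the following of its sum x, for all these w at once: if w times j+1
generic factors lies in A_(c_b), then so does w x times j generic factors.  By
induction along a sequence of blocks, the
products then land in A_(c_b) ([monochromatic_products]).  The sums themselves
are the products of a single factor, that is, the case b = 0.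

The idempotent ultrafilter is given by the Ellis-Numakura argument, phrased with
filters: closed sets of ultrafilters correspond to filters, larger filters to
smaller closed sets, so that a minimal closed subsemigroup is a maximal
[additive_filter], and Zorn's lemma applies ([idempotent_ultrafilter]). *)

(** * Idempotent ultrafilters on a semigroup *)

Section Convolution.
Context {T : Type} (op : T -> T -> T).

Definition shift (V : set_system T) (A : set T) : set T :=
  [set x | V [set y | A (op x y)]].

(** For ultrafilters this is the semigroup law of the Stone-Cech
compactification: A belongs to it when, for U-almost all x, for V-almost all y,
the element op x y lies in A. *)
Definition conv (U V : set_system T) : set_system T :=
  [set A | U (shift V A)].

Lemma shiftI V A B : Filter V -> shift V A `&` shift V B `<=` shift V (A `&` B).
Proof. by move=> FV x [VA VB]; apply: filterI VA VB. Qed.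

Lemma shiftS V A B : Filter V -> A `<=` B -> shift V A `<=` shift V B.
Proof. by move=> FV AB x; apply: filterS => y; apply: AB. Qed.

Lemma conv_proper U V :
  ProperFilter U -> ProperFilter V -> ProperFilter (conv U V).
Proof.
move=> FU FV; apply: Build_ProperFilter_ex.
  by move=> A /(filter_ex (F := U))[x /filter_ex[y Axy]]; exists (op x y).
split.
- by apply: (filterE (F := U)) => x; apply: filterE.
- move=> A B UA UB; apply: (filterS (F := U)) (filterI (F := U) UA UB).
  by move=> x; apply: shiftI.
- by move=> A B AB; apply: (filterS (F := U)); apply: shiftS.
Qed.

Lemma sub_conv (U U' V : set_system T) : U `<=` U' -> conv U V `<=` conv U' V.
Proof. by move=> UU' A; apply: UU'. Qed.

Lemma ultraP (F : set_system T) :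
  ProperFilter F -> (forall A, F A \/ F (~` A)) -> UltraFilter F.
Proof.
move=> FF dec; split=> // G FG FsG; apply/seteqP; split=> [A GA|//].
have [//|/FsG GnA] := dec A.
by have /filter_ex[x []] : G (A `&` ~` A) by exact: filterI.
Qed.

Lemma ultra_eq (U W : set_system T) :
  UltraFilter U -> ProperFilter W -> U `<=` W -> W = U.
Proof. by move=> uU pW /max_filter; apply. Qed.

Lemma conv_ultra U V : UltraFilter U -> UltraFilter V -> UltraFilter (conv U V).
Proof.
move=> uU uV; apply: ultraP => [|A]; first exact: conv_proper.
have [|UnA] := in_ultra_setVsetC (shift V A) uU; [by left|right].
apply: filterS UnA => x /= nVA.
by have [] := in_ultra_setVsetC [set y | A (op x y)] uV.
Qed.

(** Otherwise F restricted to the complement of B is still proper, and an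
ultrafilter finer than it contains F but not B. *)
Lemma mem_ultra_filter (F : set_system T) (B : set T) :
  ProperFilter F -> (forall U, UltraFilter U -> F `<=` U -> U B) -> F B.
Proof.
move=> FF ultraB; apply: contrapT => nFB.
have pW : ProperFilter (within (~` B) F).
  split; last exact: within_filter.
  move=> FnB; apply: nFB; apply: (filterS (F := F)) FnB => x /= nnB.
  exact: contrapT.
have [U [uU sU]] := ultraFilterLemma pW.
have UB : U B.
  by apply: ultraB => // A FA; apply: sU; apply: (filterS (F := F)) FA => x Ax _.
have UnB : U (~` B) by apply: sU; apply: (filterE (F := F)).
by have /filter_ex[x []] : U (B `&` ~` B) by exact: filterI.
Qed.

(** The ultrafilters finer than this filter are those U finer than F for which
W is contained in conv U V; so, for ultrafilters V and W, solving W = conv U V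
with U finer than F amounts to showing that the filter is proper. *)
Definition join_shift (F V W : set_system T) : set_system T :=
  filter_from [set CA : set T * set T | F CA.1 /\ W CA.2]
              (fun CA => CA.1 `&` shift V CA.2).

(** If some C in F missed the shift of some A in W, then the complement of A
would be in conv F V, because V decides every set; so it would be in W, as A
is. *)
Lemma join_shift_proper F V W :
    ProperFilter F -> UltraFilter V -> ProperFilter W -> conv F V `<=` W ->
  ProperFilter (join_shift F V W).
Proof.
move=> pF uV pW sFVW; apply: filter_from_proper.
  apply: filter_from_filter; first by exists (setT, setT); split; apply: filterT.
  move=> [C A] [C' A'] [/= FC WA] [/= FC' WA'].
  exists (C `&` C', A `&` A'); first by split; apply: filterI.
  by move=> x [[Cx C'x] sx]; do 2?[split=> //]; apply: shiftS sx => y [].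
move=> [C A] [/= FC WA]; apply: contrapT => CA0.
have WnA : W (~` A).
  apply: sFVW; apply: filterS FC => x Cx.
  have [VA|//] := in_ultra_setVsetC [set y | A (op x y)] uV.
  by case: CA0; exists x.
by have /filter_ex[x []] : W (A `&` ~` A) by exact: filterI.
Qed.

Lemma sub_join_shiftl F V W : Filter V -> Filter W -> F `<=` join_shift F V W.
Proof.
move=> FV FW C FC; exists (C, setT); first by split=> //; apply: filterT.
by move=> x [].
Qed.

Lemma join_shiftr F V W A : Filter F -> W A -> join_shift F V W (shift V A).
Proof.
move=> FF WA; exists (setT, A); first by split=> //; apply: filterT.
by move=> x [].
Qed.

Hypothesis opA : associative op.

Lemma convA U V W : conv U (conv V W) = conv (conv U V) W.
Proof.
apply/funext => A; congr U; apply/funext => x; congr V; apply/funext => y.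
by congr W; apply/funext => z /=; rewrite opA.
Qed.

(** The closed set of ultrafilters finer than F is a subsemigroup. *)
Definition additive_filter (F : set_system T) : Prop :=
  ProperFilter F /\
  forall U V, UltraFilter U -> UltraFilter V -> F `<=` U -> F `<=` V ->
    F `<=` conv U V.

Lemma maximal_additive_filter F0 : additive_filter F0 ->
  exists M, [/\ additive_filter M, F0 `<=` M &
    forall G, additive_filter G -> M `<=` G -> G = M].
Proof.
move=> aF0.
(* The empty family is admitted so that the empty chain has its union in P. *)
pose P (F : set_system T) := F = set0 \/ additive_filter F /\ F0 `<=` F.
have [|M [PM Mmax]] := @Zorn_bigcup _ P.
  move=> C CP Ctot.
  have [[F1 CF1 [A1 F1A1]]|Cempty] :=
      pselect (exists2 F, C F & F !=set0); last first.
    left; apply/seteqP; split=> // A [F CF FA].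
    by case: Cempty; exists F => //; exists A.
  have goodC F A : C F -> F A -> additive_filter F /\ F0 `<=` F.
    by move=> CF FA; case: (CP _ CF) => // F_0; rewrite F_0 in FA.
  right; split; last first.
    move=> A F0A; exists F1 => //.
    by have [_ ] := goodC _ _ CF1 F1A1; apply.
  split; last first.
    move=> U V uU uV sU sV A [F CF FA].
    have [[_ addF] _] := goodC _ _ CF FA.
    by apply: addF => // B FB; [apply: sU|apply: sV]; exists F.
  apply: Build_ProperFilter_ex.
    by move=> A [F CF FA]; have [[pF _] _] := goodC _ _ CF FA; apply: filter_ex FA.
  split.
  - exists F1 => //; have [[pF _] _] := goodC _ _ CF1 F1A1; exact: filterT.
  - move=> A B [F CF FA] [G CG GB].
    have [[pF _] _] := goodC _ _ CF FA; have [[pG _] _] := goodC _ _ CG GB.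
    by have [FG|GF] := Ctot _ _ CF CG;
      [exists G => //; apply: filterI => //; apply: FG
      |exists F => //; apply: filterI => //; apply: GF].
  - move=> A B AB [F CF FA]; exists F => //.
    by have [[pF _] _] := goodC _ _ CF FA; apply: filterS FA.
have maxE G : P G -> M `<=` G -> G = M.
  move=> PG MG; apply: contrapT => neq; apply: (Mmax G) => //.
  by split=> // GM; apply: neq; apply/seteqP.
have nM0 : M <> set0.
  move=> M0; have PF0 : P F0 by right; split.
  have F00 : F0 = set0 by rewrite -M0; apply: maxE => //; rewrite M0.
  have [pF _] := aF0.
  have : F0 setT by exact: filterT.
  by rewrite F00.
have [//|[aM sM]] := PM.
exists M; split=> // G aG MG; apply: maxE => //; right; split=> //.
exact: subset_trans MG.
Qed.

(** The Ellis-Numakura lemma.  The ultrafilters finer than a maximal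
additive M form a minimal closed semigroup C; take V in C.  Both C * V and
the set of the U in C with U * V = V are closed subsemigroups of C: by
minimality the first is C, so the second is nonempty, hence it is C and
contains V.  In terms of filters they are conv M V and join_shift M V V. *)
Lemma idempotent_ultrafilter F0 : additive_filter F0 ->
  exists V, [/\ UltraFilter V, F0 `<=` V & conv V V = V].
Proof.
move=> /maximal_additive_filter[M [[pM aM] sM Mmax]].
have [V [uV MV]] := ultraFilterLemma pM.
have splitW W : UltraFilter W -> conv M V `<=` W ->
    exists U, [/\ UltraFilter U, M `<=` U & W = conv U V].
  move=> uW sW.
  have pJ : ProperFilter (join_shift M V W) by apply: join_shift_proper.
  have [U [uU sU]] := ultraFilterLemma pJ.
  exists U; split=> //.
    by apply: subset_trans sU; apply: sub_join_shiftl.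
  symmetry; apply: ultra_eq; first exact: conv_proper.
  by move=> A WA; apply: sU; apply: join_shiftr.
have sMV : M `<=` conv M V.
  move=> A MA; apply: (mem_ultra_filter M) => U uU MU.
  exact: (aM U V) MA.
have MVE : conv M V = M.
  apply: Mmax => //; split; first exact: conv_proper.
  move=> W1 W2 uW1 uW2 /(splitW _ uW1)[U1 [uU1 MU1 ->]].
  move=> /(splitW _ uW2)[U2 [uU2 MU2 ->]].
  rewrite convA -(convA U1); apply: sub_conv.
  apply: (subset_trans (aM U1 (conv V U2) uU1 _ MU1 _)) => //.
    exact: conv_ultra.
  exact: (aM V U2).
have joinE : join_shift M V V = M.
  have pJ : ProperFilter (join_shift M V V).
    by apply: join_shift_proper; rewrite ?MVE.
  apply: Mmax; last exact: sub_join_shiftl.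
  have absorbs U : join_shift M V V `<=` U -> V `<=` conv U V.
    by move=> sU A VA; apply: sU; apply: join_shiftr.
  split=> // U1 U2 uU1 uU2 sU1 sU2 B [[C A] [/= MC VA]] CAB.
  have pU12 : ProperFilter (conv U1 U2) by apply: conv_proper.
  apply: filterS CAB _; apply: filterI.
    by apply: (aM U1 U2) MC => //;
      [apply: subset_trans sU1|apply: subset_trans sU2]; apply: sub_join_shiftl.
  have : conv U1 (conv U2 V) A.
    have : conv U1 V A by apply: absorbs.
    by apply: (filterS (F := U1)) => x; apply: (absorbs U2).
  by rewrite convA.
exists V; split=> //; first exact: subset_trans MV.
apply: ultra_eq; first exact: conv_proper.
by move=> A VA; apply: MV; rewrite -joinE; apply: join_shiftr.
Qed.
End Convolution.

(** * Sequences whose finite sums meet requirements *)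

Section Fusion.
Variables (V : set_system nat) (D : seq nat -> set nat).
Hypotheses (pV : ProperFilter V) (VV : V `<=` conv addn V V).
Hypothesis VD : forall s, V (D s).

(** The state consists of the elements chosen so far and of a set E of V in
which every finite sum of later elements will lie.  Keeping both E and its
translate by the new element x lets sums with and without x stay in E. *)
Local Fixpoint greedy (pick : set nat -> nat) (k : nat) : seq nat * set nat :=
  if k is k'.+1 then
    let: (s, E) := greedy pick k' in
    let x := pick E in
    let s' := rcons s x in
    (s', E `&` [set z | E (x + z)] `&` D s')
  else ([::], D [::]).

(** A member E of V contains, by idempotence, some x with the translate of E by
x still in V; such an x keeps the greedy construction going.  A finite sum with
least index M then lies in the M-th state set: if N is the next index, the rest
of the sum lies in the N-th state set by induction, hence in the translate of
the M-th one by y M. *)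
Lemma filter_finite_sums : exists y : nat -> nat,
  forall M s, path ltn M s -> D (mkseq y M) (\sum_(k <- M :: s) y k).
Proof.
have pickP (E : set nat) : exists x, V E -> E x /\ V [set z | E (x + z)].
  have [VE|] := pselect (V E); last by exists 0.
  have /filter_ex[x Ex] : V (E `&` shift addn V E).
    by apply: filterI => //; apply: VV.
  by exists x.
have [pick {}pickP] := choice pickP.
pose E k := (greedy pick k).2; pose y k := pick (E k).
have greedyE k : greedy pick k = (mkseq y k, E k).
  elim: k => // k IH.
  by rewrite /E /= IH /= mkseqS.
have ES k : E k.+1 = E k `&` [set z | E k (y k + z)] `&` D (mkseq y k.+1).
  by rewrite {1}/E /= greedyE /= mkseqS.
have VE k : V (E k).
  elim: k => [|k IH]; first exact: VD.
  rewrite ES; apply: filterI; last exact: VD.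
  by apply: filterI => //; have [] := pickP _ IH.
have ED k : E k `<=` D (mkseq y k).
  by case: k => [//|k]; rewrite ES => x [].
have Edecr i j : i <= j -> E j `<=` E i.
  move=> /subnKC <-; elim: (j - i) => [|d IH]; first by rewrite addn0.
  by rewrite addnS ES => x [[/IH]].
exists y => M s Ms; apply: ED; elim: s M Ms => [|N s IH] M.
  by move=> _; rewrite big_seq1; have [] := pickP _ (VE M).
move=> /= /andP[MN /IH EN]; rewrite big_cons.
by have := Edecr _ _ MN _ EN; rewrite ES => -[[]].
Qed.

End Fusion.

(** * Generic products *)

Lemma ultra_finite_cover (T : Type) (U : set_system T) (I : finType)
    (f : I -> set T) :
  UltraFilter U -> U [set x | exists i, f i x] -> exists i, U (f i).
Proof.
move=> uU Uf; apply: contrapT => nf.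
have : U [set x | forall i, (~` f i) x].
  apply: filter_forall => i.
  by have [Ui|] := in_ultra_setVsetC (f i) uU; [case: nf; exists i|].
move=> Unf.
have /filter_ex[x [[i fx] /(_ i)]] :
    U ([set x | exists i, f i x] `&` [set x | forall i, (~` f i) x]).
  exact: filterI.
exact.
Qed.

(** w is in tensor V A k when w x_1 ... x_k lies in A for V-almost all x_1, for
V-almost all x_2, ..., for V-almost all x_k: that is, when the k-tuples with
this property form a member of the k-th tensor power of V. *)
Fixpoint tensor (V : set_system nat) (A : set nat) (k : nat) : set nat :=
  if k is k'.+1 then [set w | V [set x | tensor V A k' (w * x)]] else A.

Lemma tensor_cover (V : set_system nat) (I : finType) (A : I -> set nat) :
  UltraFilter V -> V posint -> posint `<=` \bigcup_(i in setT) A i ->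
  forall k w, 0 < w -> exists i, tensor V (A i) k w.
Proof.
move=> uV Vpos cover; elim=> [|k IH] w w0 /=.
  by have [i _ Aiw] := cover w w0; exists i.
apply: ultra_finite_cover; apply: filterS Vpos => x x0.
by apply: IH; rewrite muln_gt0 w0.
Qed.

(** The positive integers form a subsemigroup of nat; without starting from
them, the principal ultrafilter at 0 would be a possible answer. *)
Lemma positive_idempotent :
  exists V, [/\ UltraFilter V, V posint & conv addn V V = V].
Proof.
have [|V [uV sV VV]] := idempotent_ultrafilter addn addnA (globally posint).
  split; first exact: (globally_properfilter (a := 1)).
  move=> U V uU uV sU sV A posA; have Upos : U posint by apply: sU.
  have Vpos : V posint by apply: sV.
  apply: (filterS (F := U)) Upos => x x0; apply: (filterS (F := V)) Vpos => y y0.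
  by apply: posA; rewrite /posint /= addn_gt0 x0.
by exists V; split=> //; apply: sV.
Qed.

(** * Sums over blocks and their products *)

Lemma leq_fset_max (a : {fset nat}) k : k \in a -> k <= fset_max a.
Proof. by move=> ka; rewrite /fset_max; apply: leq_bigmax_seq. Qed.

Lemma fset_min_leq (a : {fset nat}) k : k \in a -> fset_min a <= k.
Proof.
rewrite /fset_min; move: (fset_max a) => m; rewrite -[k \in a]/(k \in enum_fset a).
elim: (enum_fset a) => //= l s IH; rewrite inE big_cons geq_min.
by case/predU1P => [->|/IH ->]; rewrite ?leqnn ?orbT.
Qed.

Lemma sum_fset_sort (a : {fset nat}) (y : nat -> nat) : a != fset0 ->
  exists M s, [/\ path ltn M s, M \in a &
    \sum_(k <- a) y k = \sum_(k <- M :: s) y k].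
Proof.
move=> a0; case E : (sort leq a) => [|M s].
  have /fset0Pn[k] := a0; rewrite -[k \in a]/(k \in enum_fset a).
  by rewrite -(mem_sort leq) E.
exists M, s; split.
- suff: sorted ltn (M :: s) by [].
  rewrite -E ltn_sorted_uniq_leq sort_uniq fset_uniq sort_sorted //.
  exact: leq_total.
- by rewrite -[M \in a]/(M \in enum_fset a) -(mem_sort leq) E mem_head.
- by rewrite -E; apply/perm_big; rewrite perm_sym perm_sort.
Qed.

(** This bounds the sums over blocks before M by a quantity that depends only on the
first M elements, as the requirements of [filter_finite_sums] must. *)
Lemma leq_sum_mkseq (a : {fset nat}) (y : nat -> nat) M : fset_max a < M ->
  \sum_(k <- a) y k <= sumn (mkseq y M).
Proof.
move=> aM; rewrite sumnE big_map; apply: uniq_sub_le_big => //.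
- by move=> i j; apply: leq_addr.
- exact: iota_uniq.
- move=> k /leq_fset_max ka; rewrite mem_iota /=; exact: leq_ltn_trans ka aM.
Qed.

Lemma sum_additive_IP (y : nat -> nat) :
  (forall a, Pf posint a -> posint (\sum_(k <- a) y k)) ->
  additive_IP (fun a => \sum_(k <- a) y k).
Proof.
move=> pos; split=> // a b _ _ ab0; rewrite -big_cat; apply/perm_big.
apply: uniq_perm => [||k]; first exact: fset_uniq.
  rewrite cat_uniq !fset_uniq /= andbT; apply/hasPn => k kb; apply/negP => ka.
  have : k \in (a `&` b)%fset by rewrite inE; apply/andP.
  by rewrite ab0 inE.
by rewrite mem_cat; exact: in_fsetU.
Qed.

(** The Milliken-Taylor argument.  The product of the first k sums, over blocks
a_0 < ... < a_(k-1), is shown to lie in tensor V (B b) (b.+1 - k) by induction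
on k: the hypothesis is the case k = 0, and k = b.+1 is the conclusion. *)
Lemma monochromatic_products (V : set_system nat) n (B : 'I_n.+1 -> set nat) :
    UltraFilter V -> conv addn V V = V -> V posint ->
    (forall b : 'I_n.+1, tensor V (B b) b.+1 1) ->
  exists x, additive_IP x /\ forall b : 'I_n.+1, IP_products x b.+1 `<=` B b.
Proof.
move=> uV VV Vpos tB.
(* At most n factors precede a given one, each at most the sum of s; the
   successor inside the power makes it monotone in the exponent. *)
pose bound s := ((sumn s).+1 ^ n).+1.
pose good (wbj : nat * 'I_n.+1 * 'I_n.+1) x :=
  let: (w, b, j) := wbj in
  tensor V (B b) j.+1 w -> tensor V (B b) j (w * x).
pose D s := posint `&`
  [set x | forall t : 'I_(bound s) * 'I_n.+1 * 'I_n.+1,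
    good (t.1.1 : nat, t.1.2, t.2) x].
have VD s : V (D s).
  apply: filterI => //; apply: filter_forall => -[[w b] j] /=.
  have [tw|ntw] := pselect (tensor V (B b) j.+1 w); last exact: filterE.
  by apply: filterS tw => x.
have [|y yD] := filter_finite_sums V D _ _ VD; first by rewrite VV.
pose x (a : {fset nat}) := \sum_(k <- a) y k.
have xD a : Pf posint a -> exists2 M, M \in a & D (mkseq y M) (x a).
  move=> [a0 _]; have [M [s [Ms Ma aE]]] := sum_fset_sort a y a0.
  by exists M => //; rewrite /x aE; apply: yD.
exists x; split.
  by apply: sum_additive_IP => a /xD[M _ []].
move=> b _ [a [aP a_lt] <-].
pose z k := x (a (inord k)).
suff H k : k <= b.+1 -> tensor V (B b) (b.+1 - k) (\prod_(s < k) z s).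
  have := H _ (leqnn _); rewrite subnn /=.
  by under eq_bigr => i _ do rewrite /z inord_val.
elim: k => [_|k IH kb]; first by rewrite big_ord0 subn0; apply: tB.
have {}IH := IH (ltnW kb).
have [M Ma [_ DM]] := xD _ (aP (inord k)).
have wM : \prod_(s < k) z s < bound (mkseq y M).
  rewrite /bound ltnS.
  apply: (@leq_trans ((sumn (mkseq y M)).+1 ^ k)).
    rewrite -[X in _ ^ X]card_ord -prod_nat_const; apply: leq_prod => s _.
    apply/leqW/leq_sum_mkseq; apply: (leq_trans _ (fset_min_leq _ _ Ma)).
    by apply: a_lt; rewrite !inordK // (ltn_trans (ltn_ord s)).
  by rewrite leq_pexp2l // -ltnS; apply: leq_trans kb (ltn_ord b).
have jn : b - k < n.+1 by apply: leq_ltn_trans (leq_subr _ _) (ltn_ord b).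
rewrite big_ord_recr /= subSS.
by apply: (DM (Ordinal wM, b, Ordinal jn)); rewrite subSn in IH.
Qed.

Theorem theoremA (m : nat) (hm : 0 < m) (A : 'I_m -> set nat)
    (hA : forall i : 'I_m, A i `<=` posint)
    (hcover : posint = \bigcup_(i in [set: 'I_m]) A i) :
  forall n : nat, 0 < n ->
  exists (c : 'I_n.+1 -> 'I_m) (x : {fset nat} -> nat),
    additive_IP x /\
    forall b : 'I_n.+1, 0 < b ->
      IP_values x `<=` A (c ord0) /\
      IP_products x b.+1 `<=` A (c b).
Proof.
move=> n _; have [V [uV Vpos VV]] := positive_idempotent.
have colour (b : 'I_n.+1) : exists i, tensor V (A i) b.+1 1.
  by apply: tensor_cover => //; rewrite -hcover.
have [c cP] := choice colour.
have [x [xIP xA]] := monochromatic_products V n (A \o c) uV VV Vpos cP.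
exists c, x; split=> // b _; split; last exact: (xA b).
move=> _ [a aP <-]; apply: (xA ord0); exists (fun=> a); last by rewrite big_ord1.
by split=> // s t; rewrite !ord1.
Qed.
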